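(* The $Q$-curvature of any modified Patterson–Walker metric vanishes.
   Context: $Q$-curvature means Branson's (critical) $Q$-curvature of a pseudo-Riemannian metric on a manifold of even dimension $2n$. Modified PW metric: let $D$ be a special (i.e. preserving a volume form) torsion-free affine connection on an oriented manifold $M$ of dimension $n\ge2$. Let $\mathcal{E}(2)=(\Lambda^nTM)^{2/(n+1)}$ and $\pi:\widetilde M\to M$, $\widetilde M=T^*M\otimes\mathcal{E}(2)$, identified with $T^*M$ by the $D$-parallel volume form; $T\widetilde M=V\oplus H$ with $V\cong\pi^*T^*M$ vertical and $H\cong\pi^*TM$ the horizontal distribution of $D$. $\widetilde g$ is the split-signature metric making $V$ and $H$ isotropic and pairing them naturally; in coordinates $\widetilde g=2\,dx^A\odot dp_A-2\Gamma_A{}^C{}_Bp_C\,dx^A\odot dx^B$ with $a\odot b=\frac12(a\otimes b+b\otimes a)$. For a symmetric tensor $\Phi_{AB}\in S^2T^*M\otimes\mathcal{E}(2)$, the modified PW metric is $\overline g=\widetilde g+\pi^*\Phi$ on the $2n$-dimensional manifold $\widetilde M$. *)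

(* Defs.v *)
From HB Require Import structures.
From mathcomp Require Import all_boot all_order all_algebra.
From mathcomp Require Import all_classical all_reals all_analysis.
Set Implicit Arguments.
Unset Strict Implicit.
Unset Printing Implicit Defensive.
Import Order.TTheory GRing.Theory Num.Theory.
Import numFieldNormedType.Exports.
Local Open Scope classical_set_scope.
Local Open Scope ring_scope.

(** * Calculus on open subsets of R^d *)

Definition partial (R : realType) (d : nat) (i : 'I_d) (f : 'rV[R]_d -> R)
  : 'rV[R]_d -> R := fun x => 'D_(delta_mx 0 i) f x.

(* C^oo on the open set U *)
Definition smooth_on (R : realType) (d : nat) (U : set 'rV[R]_d)
    (f : 'rV[R]_d -> R) : Prop :=
  forall (s : seq 'I_d) (x : 'rV[R]_d), U x ->
    differentiable (foldr (@partial R d) f s) x.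

Definition smooth_mx_on (R : realType) (d p q : nat) (U : set 'rV[R]_d)
    (f : 'rV[R]_d -> 'M[R]_(p, q)) : Prop :=
  forall i j, smooth_on U (fun x => f x i j).

(** * Levi-Civita calculus of a metric g : R^d -> 'M_d given in coordinates *)

(* Gamma^k_{ij} *)
Definition christoffel (R : realType) (d : nat) (g : 'rV[R]_d -> 'M[R]_d)
    (k i j : 'I_d) (x : 'rV[R]_d) : R :=
  2^-1 * \sum_(l < d) invmx (g x) k l *
    (partial i (fun y => g y j l) x + partial j (fun y => g y i l) x
     - partial l (fun y => g y i j) x).

(* Sign convention: the round sphere has positive Ricci tensor. *)
Definition ricci (R : realType) (d : nat) (g : 'rV[R]_d -> 'M[R]_d)
    (i j : 'I_d) (x : 'rV[R]_d) : R :=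
  \sum_(k < d)
    (partial k (christoffel g k i j) x - partial j (christoffel g k i k) x
     + \sum_(l < d) (christoffel g k k l x * christoffel g l i j x
                     - christoffel g k j l x * christoffel g l i k x)).

(* g^{ij} nabla_i nabla_j f *)
Definition laplacian (R : realType) (d : nat) (g : 'rV[R]_d -> 'M[R]_d)
    (f : 'rV[R]_d -> R) (x : 'rV[R]_d) : R :=
  \sum_(i < d) \sum_(j < d) invmx (g x) i j *
    (partial i (partial j f) x
     - \sum_(k < d) christoffel g k i j x * partial k f x).

(** * The Fefferman-Graham ambient metric and the Q-curvature *)

(* Ambient coordinates are (t, x, rho), written row_mx t (row_mx x rho). *)
Definition amb_t (R : realType) (d : nat) (z : 'rV[R]_(1 + (d + 1))) : R :=
  lsubmx z 0 0.
Definition amb_rho (R : realType) (d : nat) (z : 'rV[R]_(1 + (d + 1))) : R :=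
  rsubmx (rsubmx z) 0 0.
Definition amb_point (R : realType) (d : nat) (t : R) (x : 'rV[R]_d) (rho : R)
  : 'rV[R]_(1 + (d + 1)) := row_mx t%:M (row_mx x rho%:M).

Definition ix_t (d : nat) : 'I_(1 + (d + 1)) := lshift (d + 1) ord0.
Definition ix_x (d : nat) (i : 'I_d) : 'I_(1 + (d + 1)) := rshift 1 (lshift 1 i).
Definition ix_rho (d : nat) : 'I_(1 + (d + 1)) := rshift 1 (rshift d ord0).

(* 2 rho dt^2 + 2 t dt drho + t^2 g_rho, where gr (x, rho) = g_rho (x) *)
Definition ambient_form (R : realType) (d : nat) (gr : 'rV[R]_(d + 1) -> 'M[R]_d)
    (z : 'rV[R]_(1 + (d + 1))) : 'M[R]_(1 + (d + 1)) :=
  let t := amb_t z in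
  block_mx (2 * amb_rho z)%:M (row_mx 0 t%:M)
           (col_mx 0 t%:M) (block_mx (t ^+ 2 *: gr (rsubmx z)) 0 0 0).

(* f = O(rho^m) along rho = 0, over W *)
Definition Orho (R : realType) (d : nat) (W : set 'rV[R]_d) (m : nat)
    (f : 'rV[R]_(1 + (d + 1)) -> R) : Prop :=
  forall (j : nat) (t : R) (x : 'rV[R]_d), (j < m)%N -> 0 < t -> W x ->
    iter j (partial (ix_rho d)) f (amb_point t x 0) = 0.

(* gr defines an ambient metric for the metric g on the open set W of R^d, d
   even, in normal form relative to g.  The last four clauses say that the
   Ricci tensor is O^+(rho^(d/2 - 1)) in the sense of Fefferman and Graham
   ("The ambient metric", case of even dimension). *)
Definition is_ambient (R : realType) (d : nat) (W : set 'rV[R]_d)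
    (g : 'rV[R]_d -> 'M[R]_d) (gr : 'rV[R]_(d + 1) -> 'M[R]_d) : Prop :=
  let Ric := ricci (ambient_form gr) in
  [/\ exists O : set 'rV[R]_(d + 1),
        [/\ open O, (forall x, W x -> O (row_mx x 0)), smooth_mx_on O gr &
            forall y, O y -> (gr y)^T = gr y /\ gr y \in unitmx],
      forall x, W x -> gr (row_mx x 0) = g x,
      forall I J, Orho W (d./2).-1 (Ric I J) &
      [/\ Orho W d./2 (Ric (ix_t d) (ix_t d)),
          forall i, Orho W d./2 (Ric (ix_t d) (ix_x i)) &
          Orho W d./2 (fun z => \sum_(i < d) \sum_(j < d)
            invmx (g (lsubmx (rsubmx z))) i j * Ric (ix_x i) (ix_x j) z)]].

(* Branson's critical Q-curvature, by the ambient formula of Fefferman and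
   Hirachi: Q = - (- Delta~)^(d/2) (log t) at rho = 0, t = 1.  An ambient metric
   always exists, and it is unique up to terms which do not affect the value of
   the right-hand side, so that Q is determined by g on W.  The sign is that of
   Branson: Q is the Gauss curvature for d = 2. *)
Definition Qcurvature_in_coordinates (R : realType) (d : nat)
    (W : set 'rV[R]_d) (g : 'rV[R]_d -> 'M[R]_d) (Q : 'rV[R]_d -> R) : Prop :=
  exists2 gr, is_ambient W g gr &
    forall x, W x ->
      Q x = - iter d./2 (fun f z => - laplacian (ambient_form gr) f z)
                (fun z => ln (amb_t z)) (amb_point 1 x 0).

(** * Manifolds *)

(* The map [chart i] is only meaningful on [chart_dom i], and [transition i j],
   the coordinate change from chart i to chart j, on the image of the overlap. *)
Record smoothManifold (R : realType) (d : nat) := SmoothManifold {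
  mcarrier :> topologicalType;
  chart_index : Type;
  chart_dom : chart_index -> set mcarrier;
  chart : chart_index -> mcarrier -> 'rV[R]_d;
  transition : chart_index -> chart_index -> 'rV[R]_d -> 'rV[R]_d;
  _ : hausdorff_space mcarrier;
  _ : @second_countable mcarrier;
  _ : forall i, open (chart_dom i);
  _ : forall m, exists i, chart_dom i m;
  _ : forall i m m', chart_dom i m -> chart_dom i m' ->
        chart i m = chart i m' -> m = m';
  _ : forall i m, chart_dom i m -> {for m, continuous (chart i)};
  _ : forall i (V : set mcarrier), open V -> V `<=` chart_dom i ->
        open (chart i @` V);
  _ : forall i j m, chart_dom i m -> chart_dom j m ->
        transition i j (chart i m) = chart j m;
  _ : forall i j, smooth_mx_on (chart i @` (chart_dom i `&` chart_dom j))
        (transition i j)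
}.

Definition chart_image (R : realType) (d : nat) (M : smoothManifold R d)
  (i : chart_index M) : set 'rV[R]_d := chart i @` chart_dom i.

(* jac i j m a b is the derivative of y^b in the direction x^a at m, where x, y
   are the coordinates of charts i, j. *)
Definition jac (R : realType) (d : nat) (M : smoothManifold R d)
  (i j : chart_index M) (m : M) : 'M[R]_d := 'J (transition i j) (chart i m).

Definition oriented (R : realType) (d : nat) (M : smoothManifold R d) : Prop :=
  forall (i j : chart_index M) m, chart_dom i m -> chart_dom j m ->
    0 < \det (jac i j m).

(* Section of S^2 T*M *)
Record symTensor (R : realType) (d : nat) (M : smoothManifold R d) := SymTensor {
  tcomp :> chart_index M -> 'rV[R]_d -> 'M[R]_d;
  _ : forall i, smooth_mx_on (chart_image i) (tcomp i);
  _ : forall i x, chart_image i x -> (tcomp i x)^T = tcomp i x;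
  _ : forall i j m, chart_dom i m -> chart_dom j m ->
        tcomp i (chart i m)
        = jac i j m *m tcomp j (chart j m) *m (jac i j m)^T
}.

Record pseudoRiemannianMetric (R : realType) (d : nat) (M : smoothManifold R d)
  := PseudoRiemannianMetric {
  metric_tensor :> symTensor M;
  _ : forall i x, chart_image i x -> metric_tensor i x \in unitmx
}.

Definition is_Qcurvature (R : realType) (d : nat) (M : smoothManifold R d)
    (g : pseudoRiemannianMetric M) (Q : M -> R) : Prop :=
  forall i : chart_index M,
    exists2 q, Qcurvature_in_coordinates (chart_image i) (g i) q &
      forall m, chart_dom i m -> Q m = q (chart i m).

(* Torsion-free affine connection; conn i A C B is the Christoffel symbol
   Gamma_A^C_B of chart i, i.e. D_(d_A) d_B = Gamma_A^C_B d_C. *)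
Record torsionFreeConnection (R : realType) (d : nat) (M : smoothManifold R d)
  := TorsionFreeConnection {
  conn :> chart_index M -> 'I_d -> 'I_d -> 'I_d -> 'rV[R]_d -> R;
  _ : forall i A C B, smooth_on (chart_image i) (conn i A C B);
  _ : forall i A C B x, chart_image i x -> conn i A C B x = conn i B C A x;
  _ : forall i j m, chart_dom i m -> chart_dom j m -> forall A B K,
        \sum_(C < d) conn i A C B (chart i m) * jac i j m C K
        = \sum_(E < d) \sum_(F < d)
            jac i j m A E * jac i j m B F * conn j E K F (chart j m)
          + partial A (partial B (fun x => transition i j x 0 K)) (chart i m)
}.

(* Positive volume form: it equals vcomp i dx^1 /\ ... /\ dx^d in chart i. *)
Record volumeForm (R : realType) (d : nat) (M : smoothManifold R d) := VolumeForm {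
  vcomp :> chart_index M -> 'rV[R]_d -> R;
  _ : forall i, smooth_on (chart_image i) (vcomp i);
  _ : forall i x, chart_image i x -> 0 < vcomp i x;
  _ : forall i j m, chart_dom i m -> chart_dom j m ->
        vcomp i (chart i m) = \det (jac i j m) * vcomp j (chart j m)
}.

Definition parallel_volume (R : realType) (d : nat) (M : smoothManifold R d)
    (D : torsionFreeConnection M) (vol : volumeForm M) : Prop :=
  forall i x, chart_image i x -> forall A,
    partial A (vol i) x = (\sum_(C < d) D i A C C x) * vol i x.

Definition special (R : realType) (d : nat) (M : smoothManifold R d)
    (D : torsionFreeConnection M) : Prop :=
  exists vol : volumeForm M, parallel_volume D vol.

(* T*M as a manifold, with the atlas of charts (x^A, p_A) = row_mx x p induced by
   the charts of M; chart k of T*M is induced by the chart [base_chart k]. *)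
Record cotangentBundle (R : realType) (n : nat) (M : smoothManifold R n)
  := CotangentBundle {
  total :> smoothManifold R (n + n);
  proj : total -> M;
  base_chart : chart_index total -> chart_index M;
  _ : forall i, exists k, base_chart k = i;
  _ : forall k, chart_dom k = proj @^-1` chart_dom (base_chart k);
  _ : forall k z, chart_dom k z ->
        lsubmx (chart k z) = chart (base_chart k) (proj z);
  _ : forall k m (p : 'rV[R]_n), chart_dom (base_chart k) m ->
        exists2 z, proj z = m & rsubmx (chart k z) = p;
  _ : forall k l z, chart_dom k z -> chart_dom l z ->
        rsubmx (chart k z)
        = rsubmx (chart l z) *m (jac (base_chart k) (base_chart l) (proj z))^T
}.

(** * Patterson-Walker metrics *)

(* 2 dx^A (.) dp_A - 2 Gamma_A^C_B p_C dx^A (.) dx^B + Phi_AB dx^A (.) dx^B,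
   where a (.) b = (a (x) b + b (x) a) / 2 *)
Definition PW_form (R : realType) (n : nat)
    (Gam : 'I_n -> 'I_n -> 'I_n -> 'rV[R]_n -> R) (Phi : 'rV[R]_n -> 'M[R]_n)
    (z : 'rV[R]_(n + n)) : 'M[R]_(n + n) :=
  let x := lsubmx z in
  let p := rsubmx z in
  block_mx
    (\matrix_(A, B) (- 2 * \sum_(C < n) Gam A C B x * p 0 C) + Phi x) 1%:M
    1%:M 0.

(* The total space T*M (x) E(2) and the tensor Phi in S^2 T*M (x) E(2) are both
   read on T*M and S^2 T*M, E(2) being trivialized by the parallel volume form. *)
Definition is_modified_PW (R : realType) (n : nat) (M : smoothManifold R n)
    (D : torsionFreeConnection M) (Phi : symTensor M) (T : cotangentBundle M)
    (g : pseudoRiemannianMetric T) : Prop :=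
  forall (k : chart_index T) z, chart_image k z ->
    g k z = PW_form (D (base_chart k)) (Phi (base_chart k)) z.

(* Main.v *)
Require Import Defs.
From mathcomp Require Import all_boot all_order all_algebra.
From mathcomp Require Import all_classical all_reals all_analysis.
From mathcomp Require Import ring.
Set Implicit Arguments.
Unset Strict Implicit.
Unset Printing Implicit Defensive.
Import Order.TTheory GRing.Theory Num.Theory.
Import numFieldNormedType.Exports.
Local Open Scope classical_set_scope.
Local Open Scope ring_scope.

(** Q is read off from an ambient metric, and a modified Patterson-Walker metric
    has a very simple one. In a chart (x^A, p_A) the metric is
    2 dx^A dp_A + h_AB dx^A dx^B with h affine in p. Let S be the symmetrised
    Ricci tensor of D divided by n - 1 ([proj_schouten]), and let g_rho be
    obtained from the metric by adding 2 rho S_AB dx^A dx^B ([PW_family]).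

    The ambient metric built from g_rho is Ricci-flat for t > 0 and every rho
    ([ricci_ambient]), not just to the order required at rho = 0. The reason is
    that the inverse of g_rho has no component along d/dx^A d/dx^B, so that
    the trace of S, the product of S with itself and, since S does not depend on
    p, the divergence of S all vanish. What is left is the
    dx^A dx^B component, where the Ricci tensor of g_rho, twice the symmetrised
    Ricci tensor of D, cancels against 2 (n - 1) S. The tensor Phi drops out.

    The determinant of g_rho is constant, so the volume density of the
    ambient metric is, up to sign, t^(2n+1), which does not depend on rho. Since
    dt is dual to d/drho up to the factor 1/t, the Laplacian of log t is
    t^(-2n-1) d/drho (t^(2n+1) t^(-1) t^(-1)) = 0 ([laplacian_ln_ambient]).
    Hence all its iterated Laplacians vanish, and Q, which is the n-th one up to
    sign, is zero.

    The computation of the Ricci tensor is split in two. The Christoffel symbols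
    and the required derivatives of them are tabulated as algebraic
    expressions in the values at a point of t, rho, Gamma, S, h and their
    derivatives, and the tensor identities become identities between such
    tables ([symbol_dmetric], [ricci_symbol], [laplacian_symbol]). The analytic
    part then only has to show that the tables are the actual symbols and
    derivatives ([christoffel_ambient], [is_derive_symbol_div],
    [is_derive_symbol_trace]). *)

(** * Derivatives along a direction *)

Section DirectionalDerivatives.
Variable R : realType.

Lemma derive_eq_on (d : nat) (U : set 'rV[R]_d) (f g : 'rV[R]_d -> R) x v :
  open U -> U x -> {in U, f =1 g} -> 'D_v f x = 'D_v g x.
Proof.
move=> oU Ux fg; have [->|v0] := eqVneq v 0; first by rewrite !derive0.
apply: near_eq_derive => //.
by near=> y; apply: fg; rewrite inE; near: y; exact: open_nbhs_nbhs.
Unshelve. all: by end_near. Qed.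

Lemma partial_eq_on (d : nat) (U : set 'rV[R]_d) (f g : 'rV[R]_d -> R) i :
  open U -> {in U, f =1 g} -> {in U, partial i f =1 partial i g}.
Proof.
by move=> oU fg x; rewrite inE => Ux; exact: (derive_eq_on _ oU Ux fg).
Qed.

Lemma derive_comp_linear (V W : normedModType R) (L : V -> W) (f : W -> R) x v :
  (forall h, L (h *: v + x) = h *: L v + L x) ->
  'D_v (f \o L) x = 'D_(L v) f (L x).
Proof.
move=> Ll; rewrite /derive.
set q1 := (fun h : R => _); set q2 := (fun h : R => _).
by have -> : q1 = q2 by apply/funext => h; rewrite /q1 /q2 /= Ll.
Qed.

Lemma is_derive_comp_linear (V W : normedModType R) (L : V -> W) (f : W -> R)
    x v w df :
  (forall h, L (h *: v + x) = h *: L v + L x) -> L v = w ->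
  is_derive (L x) w f df -> is_derive x v (f \o L) df.
Proof.
move=> Ll <- [fd <-]; split; last exact: derive_comp_linear.
move: fd; rewrite /derivable.
set q2 := (fun h : R => _); set q1 := (fun h : R => _).
by have -> : q1 = q2 by apply/funext => h; rewrite /q1 /q2 /= Ll.
Qed.

(** Along d/dt, d/dp and d/drho nearly all the functions differentiated below are
    affine or constant, so that their derivative is an exact increment. *)
Lemma is_derive_affine (d : nat) (f : 'rV[R]_d -> R) x v c :
  (forall h, f (h *: v + x) = h * c + f x) -> is_derive x v f c.
Proof.
move=> fl.
have fcvg : (fun h : R => h^-1 *: ((f \o shift x) (h *: v) - f x)) @ 0^' --> c.
  apply: (@cvg_trans _ ((fun=> c) @ (0 : R)^')); last exact: cvg_cst.
  apply: near_eq_cvg; near=> h => /=.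
  rewrite fl addrK [_ *: _]mulKf //; near: h; exact: nbhs_dnbhs_neq.
by split; [exact: cvgP fcvg | exact: cvg_lim].
Unshelve. all: by end_near. Qed.

Lemma is_derive_bigsum (d n : nat) (f : 'I_n -> 'rV[R]_d -> R) x v
    (df : 'I_n -> R) :
  (forall i, is_derive x v (f i) (df i)) ->
  is_derive x v (fun y => \sum_(i < n) f i y) (\sum_(i < n) df i).
Proof.
move=> fd; have := @is_derive_sum R _ _ n f x v df fd.
by congr is_derive; apply/funext => y; rewrite fct_sumE.
Qed.

Lemma is_derive_prod (d : nat) (f g : 'rV[R]_d -> R) x v (df dg : R) :
  is_derive x v f df -> is_derive x v g dg ->
  is_derive x v (fun y => f y * g y) (f x * dg + g x * df).
Proof. exact: is_deriveM. Qed.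

Lemma vanish_iter_partial (d : nat) (U : set 'rV[R]_d) (f : 'rV[R]_d -> R) i j :
  open U -> (forall x, U x -> f x = 0) ->
  forall x, U x -> iter j (partial i) f x = 0.
Proof.
move=> oU f0; elim: j => [//|j IH] x Ux /=.
rewrite /partial (@derive_eq_on _ U _ (cst 0)) ?derive_cst//.
by move=> y; rewrite inE => /IH.
Qed.

End DirectionalDerivatives.

(** * Smooth functions on an open set *)

Section SmoothFunctions.
Variable R : realType.

(** Differentiability is local because a function which vanishes near a point is
    differentiable there; this is what allows partial derivatives to be computed
    on an open set only. *)
Lemma differentiable_near0 (d : nat) (f : 'rV[R]_d -> R) x :
  (\forall y \near x, f y = 0) -> differentiable f x.
Proof.
move=> f0; have fx0 : f x = 0 := nbhs_singleton f0.
have fE : f \o shift x = cst (f x) + (0 : 'rV[R]_d -> R) +o_ (0 : 'rV[R]_d) id.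
  apply/eqaddoP => _/posnumP[eps]; near=> y.
  rewrite /= fx0 /cst !fctE /= addr0 subr0.
  have -> : f (y + x) = 0.
    near: y; have := f0; rewrite (near_shift 0 x) /=.
    by apply: filterS => z /=; rewrite subr0.
  by rewrite normr0 mulr_ge0.
have d0 := @diff_unique R _ _ f (\0 : {linear _ -> _}) x (@cst_continuous _ _ _) fE.
by apply/diff_locallyP; rewrite d0; split => //; exact: cst_continuous.
Unshelve. all: by end_near. Qed.

Lemma differentiable_eq_on (d : nat) (U : set 'rV[R]_d) f g x :
  open U -> {in U, f =1 g} -> U x -> differentiable f x ->
  differentiable (g : _ -> R) x.
Proof.
move=> oU fg Ux df; have -> : g = f + (fun y => g y - f y).
  by apply/funext => y; rewrite fctE subrKC.
apply: differentiableD => //; apply: differentiable_near0.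
near=> y; rewrite fg ?subrr// inE; near: y; exact: open_nbhs_nbhs.
Unshelve. all: by end_near. Qed.

(** Peels off the innermost derivative first, unlike [smooth_on]: a product rule
    for the first derivative then suffices for an induction on [k]. *)
Fixpoint Ck (d k : nat) (U : set 'rV[R]_d) (f : 'rV[R]_d -> R) : Prop :=
  (forall x, U x -> differentiable f x) /\
  if k is k'.+1 then forall i, Ck k' U (partial i f) else True.

Lemma smooth_onP (d : nat) (U : set 'rV[R]_d) f :
  smooth_on U f <-> forall k, Ck k U f.
Proof.
split.
  move=> sf k; elim: k f sf => [|k IH] f sf /=; split => //.
  - by move=> x /(sf [::]).
  - by move=> x /(sf [::]).
  - by move=> i; apply: IH => s x /(sf (rcons s i)); rewrite foldr_rcons.
move=> + s; elim/last_ind: s f => [|s i IH] f Cf x Ux /=.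
  exact: (proj1 (Cf 0%N)).
by rewrite foldr_rcons; apply: IH => // k; apply: (proj2 (Cf k.+1)).
Qed.

Lemma CkW (d k : nat) (U : set 'rV[R]_d) f : Ck k.+1 U f -> Ck k U f.
Proof.
elim: k f => [|k IH] f [df pf]; split => // i; exact/IH/pf.
Qed.

Lemma Ck_eq_on (d k : nat) (U : set 'rV[R]_d) f g :
  open U -> {in U, f =1 g} -> Ck k U f -> Ck k U g.
Proof.
move=> oU; elim: k f g => [|k IH] f g fg /= [df pf]; split => //.
- by move=> x Ux; exact: (differentiable_eq_on oU fg Ux (df x Ux)).
- by move=> x Ux; exact: (differentiable_eq_on oU fg Ux (df x Ux)).
- by move=> i; apply: IH (pf i); exact: partial_eq_on.
Qed.

Lemma Ck_cst (d k : nat) (U : set 'rV[R]_d) (a : R) : Ck k U (cst a).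
Proof.
elim: k a => [|k IH] a /=; split => // i.
by have -> : partial i (cst a) = cst 0 by apply/funext => x; exact: derive_cst.
Qed.

Lemma CkD (d k : nat) (U : set 'rV[R]_d) f g : open U ->
  Ck k U f -> Ck k U g -> Ck k U (fun x => f x + g x).
Proof.
move=> oU; elim: k f g => [|k IH] f g [df pf] [dg pg]; split => //.
- by move=> x Ux; apply: differentiableD; [exact: df|exact: dg].
- by move=> x Ux; apply: differentiableD; [exact: df|exact: dg].
- move=> i; apply: (Ck_eq_on oU) (IH _ _ (pf i) (pg i)) => x.
  rewrite inE => Ux; rewrite /partial deriveD//; apply: diff_derivable;
    [exact: df|exact: dg].
Qed.

Lemma CkM (d k : nat) (U : set 'rV[R]_d) f g : open U ->
  Ck k U f -> Ck k U g -> Ck k U (fun x => f x * g x).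
Proof.
move=> oU; elim: k f g => [|k IH] f g Cf Cg.
  by split => // x Ux; apply: differentiableM; [exact: (proj1 Cf)|exact: (proj1 Cg)].
have [df pf] := Cf; have [dg pg] := Cg; split.
  by move=> x Ux; apply: differentiableM; [exact: df|exact: dg].
move=> i; have C := CkD oU (IH _ _ (CkW Cf) (pg i)) (IH _ _ (CkW Cg) (pf i)).
apply: (Ck_eq_on oU) C => x; rewrite inE => Ux.
rewrite /partial deriveM//; apply: diff_derivable; [exact: df|exact: dg].
Qed.

Lemma Ck_linear (d k : nat) (U : set 'rV[R]_d) (f : 'rV[R]_d -> R) :
  (forall x, differentiable f x) ->
  (forall a x y, f (a *: x + y) = a * f x + f y) -> Ck k U f.
Proof.
move=> df fl; case: k => [|k] /=; split => // i.
have -> : partial i f = cst (f (delta_mx 0 i)); last exact: Ck_cst.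
by apply/funext => x; apply: (@derive_val _ _ _ _ _ _ _ (is_derive_affine _)).
Qed.

(** When L sends each basis vector to a basis vector or to 0, the partial
    derivatives of f \o L are 0 or again of the form f' \o L with f' a partial
    derivative of f, which makes the induction go through. *)
Lemma Ck_comp (d e k : nat) (U : set 'rV[R]_e) (L : 'rV[R]_d -> 'rV[R]_e) f :
  (forall x, differentiable L x) ->
  (forall a x y, L (a *: x + y) = a *: L x + L y) ->
  (forall i, L (delta_mx 0 i) = 0 \/ exists j, L (delta_mx 0 i) = delta_mx 0 j) ->
  Ck k U f -> Ck k (L @^-1` U) (f \o L).
Proof.
move=> dL lL bL; elim: k f => [|k IH] f [df pf].
  by split => // x Ux; apply: differentiable_comp => //; exact: df.
split; first by move=> x Ux; apply: differentiable_comp => //; exact: df.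
move=> i; have pE x : partial i (f \o L) x = 'D_(L (delta_mx 0 i)) f (L x).
  exact: derive_comp_linear.
have [Li|[j Li]] := bL i.
  have -> : partial i (f \o L) = cst 0; last exact: Ck_cst.
  by apply/funext => x; rewrite pE Li derive0.
have -> : partial i (f \o L) = partial j f \o L; last exact/IH/pf.
by apply/funext => x; rewrite pE Li.
Qed.

Lemma smooth_cst (d : nat) (U : set 'rV[R]_d) (a : R) : smooth_on U (fun=> a).
Proof. by apply/smooth_onP => k; exact: Ck_cst. Qed.

Lemma smoothD (d : nat) (U : set 'rV[R]_d) f g : open U ->
  smooth_on U f -> smooth_on U g -> smooth_on U (fun x => f x + g x).
Proof.
by move=> oU /smooth_onP sf /smooth_onP sg; apply/smooth_onP => k; exact: CkD.
Qed.

Lemma smoothM (d : nat) (U : set 'rV[R]_d) f g : open U ->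
  smooth_on U f -> smooth_on U g -> smooth_on U (fun x => f x * g x).
Proof.
by move=> oU /smooth_onP sf /smooth_onP sg; apply/smooth_onP => k; exact: CkM.
Qed.

Lemma smooth_sum (d m : nat) (U : set 'rV[R]_d) (f : 'I_m -> 'rV[R]_d -> R) :
  open U -> (forall i, smooth_on U (f i)) ->
  smooth_on U (fun x => \sum_(i < m) f i x).
Proof.
move=> oU sf; rewrite -[fun _ => _]fct_sumE.
elim/big_ind: _ => // [|g h]; [exact: smooth_cst|exact: smoothD].
Qed.

Lemma smooth_partial (d : nat) (U : set 'rV[R]_d) f i :
  smooth_on U f -> smooth_on U (partial i f).
Proof.
by move=> /smooth_onP sf; apply/smooth_onP => k; apply: (proj2 (sf k.+1)).
Qed.

Lemma smooth_differentiable (d : nat) (U : set 'rV[R]_d) f x :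
  smooth_on U f -> U x -> differentiable f x.
Proof. by move=> sf /(sf [::]). Qed.

Lemma smooth_linear (d : nat) (U : set 'rV[R]_d) (f : 'rV[R]_d -> R) :
  (forall x, differentiable f x) ->
  (forall a x y, f (a *: x + y) = a * f x + f y) -> smooth_on U f.
Proof. by move=> df fl; apply/smooth_onP => k; exact: Ck_linear. Qed.

Lemma smooth_comp (d e : nat) (U : set 'rV[R]_e) (L : 'rV[R]_d -> 'rV[R]_e) f :
  (forall x, differentiable L x) ->
  (forall a x y, L (a *: x + y) = a *: L x + L y) ->
  (forall i, L (delta_mx 0 i) = 0 \/ exists j, L (delta_mx 0 i) = delta_mx 0 j) ->
  smooth_on U f -> smooth_on (L @^-1` U) (f \o L).
Proof.
by move=> dL lL bL /smooth_onP sf; apply/smooth_onP => k; exact: Ck_comp.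
Qed.

End SmoothFunctions.

(** * Ambient indices *)

Lemma sum_delta (R : pzRingType) n (A : 'I_n) (F K : 'I_n -> R) :
  (forall B, F B = (A == B)%:R * K B) -> \sum_(B < n) F B = K A.
Proof.
move=> FK; rewrite (bigD1 A)//= FK eqxx mul1r big1 ?addr0// => B /negbTE BA.
by rewrite FK eq_sym BA mul0r.
Qed.

(** The four kinds of ambient coordinates t, x^A, p_A, rho. Tables of tensor
    components are functions on this type, so that a tensor identity splits into
    cases by pattern matching. *)
Inductive ambient_index (n : nat) := It | Ix of 'I_n | Ip of 'I_n | Ir.
Arguments It {n}.
Arguments Ir {n}.

Definition same_index n (I J : ambient_index n) : bool :=
  match I, J with
  | It, It | Ir, Ir => true
  | Ix A, Ix B | Ip A, Ip B => A == B
  | _, _ => false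
  end.

Definition sum_index (V : nmodType) n (F : ambient_index n -> V) : V :=
  F It + \sum_(A < n) F (Ix A) + \sum_(A < n) F (Ip A) + F Ir.

(** Removes the sums whose general term is syntactically a product or sum of
    zeros; tables are sparse and most contractions are of this kind. *)
Ltac drop_sum := match goal with
  |- context [ @bigop.body ?T ?X ?x0 ?r ?b ] =>
     let H := fresh in
     have H : @bigop.body T X x0 r b = 0; [
       apply: big1 => ? _; rewrite /=; drop_sums;
           match goal with |- 0 = 0 => reflexivity end |
     rewrite {}H ]
  end
with drop_sums :=
  repeat drop_sum; rewrite ?(mulr0, mul0r, addr0, add0r, subr0, oppr0).

Section Indices.
Variable n : nat.
Notation N := (1 + ((n + n) + 1))%N.

Definition aix (I : ambient_index n) : 'I_N :=
  match I with
  | It => ix_t (n + n)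
  | Ix A => ix_x (lshift n A)
  | Ip A => ix_x (rshift n A)
  | Ir => ix_rho (n + n)
  end.

Definition xia (i : 'I_N) : ambient_index n :=
  match fintype.split i with
  | inl _ => It
  | inr j => match fintype.split j with
    | inr _ => Ir
    | inl k => match fintype.split k with inl A => Ix A | inr A => Ip A end
    end
  end.

Lemma aixK : cancel aix xia.
Proof.
case=> [|A|A|]; rewrite /xia /= /ix_t /ix_x /ix_rho.
- by rewrite (unsplitK (inl _)).
- by rewrite (unsplitK (inr _)) (unsplitK (inl _)) (unsplitK (inl _)).
- by rewrite (unsplitK (inr _)) (unsplitK (inl _)) (unsplitK (inr _)).
- by rewrite (unsplitK (inr _)) (unsplitK (inr _)).
Qed.

Lemma xiaK : cancel xia aix.
Proof.
move=> i; case: (fintype.split_ordP i) => [j -> | j ->].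
  by rewrite (ord1 j) -[lshift _ _]/(aix It) aixK.
case: (fintype.split_ordP j) => [k -> | k ->]; last first.
  by rewrite (ord1 k) -[rshift _ _]/(aix Ir) aixK.
case: (fintype.split_ordP k) => [A -> | A ->].
  by rewrite -[rshift _ _]/(aix (Ix A)) aixK.
by rewrite -[rshift _ _]/(aix (Ip A)) aixK.
Qed.

Lemma eq_aix I J : (aix I == aix J) = same_index I J.
Proof.
by case: I J => [|A|A|] [|B|B|]; rewrite /= /ix_t /ix_x /ix_rho ?eq_shift.
Qed.

Lemma sum_indexE (V : nmodType) (F : ambient_index n -> V) :
  sum_index F = \sum_i F (xia i).
Proof.
rewrite !big_split_ord /= !big_ord1 !addrA.
rewrite -[lshift _ _]/(aix It) aixK -[rshift _ (rshift _ _)]/(aix Ir) aixK.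
rewrite /sum_index; congr (_ + _ + _ + _); apply: eq_bigr => A _.
  by rewrite -[rshift _ _]/(aix (Ix A)) aixK.
by rewrite -[rshift _ _]/(aix (Ip A)) aixK.
Qed.

Lemma sum_aix (V : nmodType) (F : 'I_N -> V) :
  \sum_i F i = sum_index (fun I => F (aix I)).
Proof. by rewrite sum_indexE; apply: eq_bigr => i _; rewrite xiaK. Qed.

Lemma eq_sum_index (V : nmodType) (F F' : ambient_index n -> V) :
  F =1 F' -> sum_index F = sum_index F'.
Proof. by move=> FF'; rewrite !sum_indexE; apply: eq_bigr => i _; rewrite FF'. Qed.

End Indices.

(** * Algebraic tables for the ambient metric *)

Section Algebra.
(** Values at a point: [h] is the dx dx block of g_rho, [u] the same block at
    rho = 0 and [s] the tensor S; [gam A C B] is Gamma_A^C_B, [dh C A B] is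
    the derivative of [h A B] along x^C, and below [dgam C A E B] is that of
    [gam A E B]. *)
Variables (F : realFieldType) (n : nat) (t rho : F) (h s u : 'I_n -> 'I_n -> F).
Variables (gam dh : 'I_n -> 'I_n -> 'I_n -> F).
Notation idx := (ambient_index n).
Implicit Types (I J K L : idx).

Definition metric_entry I J : F :=
  match I, J with
  | It, It => 2 * rho
  | It, Ir | Ir, It => t
  | Ix A, Ix B => t ^+ 2 * h A B
  | Ix A, Ip B | Ip A, Ix B => t ^+ 2 * (A == B)%:R
  | _, _ => 0
  end.

Definition inverse_entry I J : F :=
  match I, J with
  | It, Ir | Ir, It => t^-1
  | Ir, Ir => - 2 * rho / t ^+ 2
  | Ix A, Ip B | Ip A, Ix B => (A == B)%:R / t ^+ 2
  | Ip A, Ip B => - h A B / t ^+ 2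
  | _, _ => 0
  end.

(** [dmetric L I J] is the derivative of [metric_entry I J] along L. *)
Definition dmetric L I J : F :=
  match I, J with
  | It, It => if L is Ir then 2 else 0
  | It, Ir | Ir, It => if L is It then 1 else 0
  | Ix A, Ix B =>
      match L with
      | It => 2 * t * h A B
      | Ix C => t ^+ 2 * dh C A B
      | Ip C => t ^+ 2 * (- 2 * gam A C B)
      | Ir => t ^+ 2 * (2 * s A B)
      end
  | Ix A, Ip B | Ip A, Ix B => if L is It then 2 * t * (A == B)%:R else 0
  | _, _ => 0
  end.

(** [symbol K I J] is the Christoffel symbol with upper index K. *)
Definition symbol K I J : F :=
  match K, I, J with
  | It, Ix A, Ix B => - (t * s A B)
  | Ir, It, Ir | Ir, Ir, It => t^-1
  | Ir, Ix A, Ix B => - u A B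
  | Ir, Ix A, Ip B | Ir, Ip B, Ix A => - (A == B)%:R
  | Ix C, It, Ix B | Ix C, Ix B, It => (C == B)%:R / t
  | Ix C, Ix A, Ix B => gam A C B
  | Ip C, It, Ip B | Ip C, Ip B, It => (C == B)%:R / t
  | Ip C, Ix A, Ix B =>
      2^-1 * (dh A B C + dh B A C - dh C A B) - \sum_(D < n) h C D * gam A D B
  | Ip C, Ix A, Ip B | Ip C, Ip B, Ix A => - gam A B C
  | Ip C, Ix A, Ir | Ip C, Ir, Ix A => s C A
  | _, _, _ => 0
  end.

Hypothesis t0 : t != 0.

Lemma metric_inverse I J :
  sum_index (fun K => metric_entry I K * inverse_entry K J) = (same_index I J)%:R.
Proof.
rewrite /sum_index; case: I J => [|A|A|] [|B|B|] /=; drop_sums => //.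
- by rewrite mulfV.
- by field.
- rewrite (@sum_delta _ _ A _ (fun C => (C == B)%:R)) // => C.
  by field.
- rewrite (@sum_delta _ _ B _ (fun C => h A C)); last first.
    by move=> C; rewrite eq_sym; field.
  rewrite (@sum_delta _ _ A _ (fun C => - h C B)); last first.
    by move=> C; field.
  by rewrite addrN.
- rewrite (@sum_delta _ _ A _ (fun C => (C == B)%:R)) // => C.
  by field.
- by rewrite mulfV.
Qed.

Hypothesis h_s_u : forall A B, h A B = u A B + 2 * rho * s A B.
Hypothesis gam_sym : forall A C B, gam A C B = gam B C A.
Hypothesis h_sym : forall A B, h A B = h B A.
Hypothesis s_sym : forall A B, s A B = s B A.

Lemma symbol_dmetric K I J :
  2^-1 * sum_index (fun L =>
    inverse_entry K L * (dmetric I J L + dmetric J I L - dmetric L I J))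
  = symbol K I J.
Proof.
(* contraction with the off-diagonal dx dp block of the inverse metric *)
have pick C X Y : (forall A, X A = (C == A)%:R / t ^+ 2 * (2 * Y A)) ->
    2^-1 * \sum_(A < n) X A = Y C / t ^+ 2.
  move=> XY; rewrite (@sum_delta _ _ C _ (fun A => 2 * Y A / t ^+ 2)).
    by field.
  by move=> A; rewrite XY; ring.
rewrite /sum_index; case: K I J => [|C|C|] [|A|A|] [|B|B|] /=; drop_sums => //;
  try by field.
- rewrite (pick C _ (fun A => t * (B == A)%:R)); last by move=> A; ring.
  by rewrite eq_sym; field.
- rewrite (pick C _ (fun B => t * (A == B)%:R)); last by move=> B; ring.
  by rewrite eq_sym; field.
- rewrite (pick C _ (fun D => t ^+ 2 * gam A D B)); last by move=> D; ring.
  by field.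
- rewrite mulrDr (pick C _ (fun A => t * h B A)); last by move=> A; ring.
  rewrite (@sum_delta _ _ B _ (fun A => - 2 * t * h C A / t ^+ 2)).
    by rewrite h_sym; field.
  by move=> A; ring.
- rewrite (pick C _ (fun A => t * (B == A)%:R)); last by move=> A; ring.
  by rewrite eq_sym; field.
- rewrite mulrDr (pick C _ (fun B => t * h A B)); last by move=> B; ring.
  rewrite (@sum_delta _ _ A _ (fun B => - 2 * t * h C B / t ^+ 2)).
    by rewrite h_sym; field.
  by move=> B; ring.
- rewrite mulrDr.
  rewrite (pick C _ (fun D => t ^+ 2 * (2^-1 * (dh A B D + dh B A D - dh D A B))));
    last by move=> D; field.
  rewrite mulr_sumr -sumrN; congr (_ + _); first by field.
  by apply: eq_bigr => D _; field.
- rewrite (pick C _ (fun D => - (t ^+ 2 * gam A B D))); last by move=> D; ring.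
  by field.
- rewrite (pick C _ (fun D => t ^+ 2 * s A D)); last by move=> D; ring.
  by rewrite s_sym; field.
- rewrite (pick C _ (fun B => t * (A == B)%:R)); last by move=> B; ring.
  by rewrite eq_sym; field.
- rewrite (pick C _ (fun D => - (t ^+ 2 * gam B A D))); last by move=> D; ring.
  by field.
- rewrite (pick C _ (fun D => t ^+ 2 * s B D)); last by move=> D; ring.
  by rewrite s_sym; field.
- by rewrite h_s_u; field.
- by rewrite eq_sym; field.
Qed.

(** The trace is the logarithmic derivative of the volume density t^(2n+1); the
    x^C and p_C contributions of Gamma cancel because the determinant of g_rho is
    constant. *)
Lemma symbol_trace L :
  sum_index (fun K => symbol K K L) = if L is It then (2 * n + 1)%:R / t else 0.
Proof.
rewrite /sum_index; case: L => [|A|A|] /=; drop_sums => //.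
- have -> : \sum_(C < n) (C == C)%:R / t = n%:R / t.
    under eq_bigr do rewrite eqxx.
    by rewrite sumr_const card_ord -mulr_natr mulr1n; ring.
  by rewrite natrD natrM; field.
- rewrite -big_split /= big1 // => C _.
  by rewrite gam_sym addrN.
Qed.

Lemma symbol_quadratic I J :
  sum_index (fun K => sum_index (fun L => symbol K J L * symbol L I K)) =
  match I, J with
  | It, It => (2 * n + 1)%:R / t ^+ 2
  | Ix A, Ix B =>
      - 4 * s A B + 2 * \sum_(C < n) \sum_(D < n) gam B C D * gam A D C
  | _, _ => 0
  end.
Proof.
rewrite /sum_index; case: I J => [|A|A|] [|B|B|] /=; drop_sums => //.
- have dd A : \sum_(B < n) (A == B)%:R / t * ((B == A)%:R / t) = t ^- 2.
    rewrite (@sum_delta _ _ A _ (fun B => (B == A)%:R / t / t)).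
      by rewrite eqxx mul1r; field.
    by move=> B; ring.
  have -> : \sum_(A < n)
      (0 + \sum_(B < n) (A == B)%:R / t * ((B == A)%:R / t) + 0 + 0) = n%:R / t ^+ 2.
    under eq_bigr do rewrite dd !addr0 add0r.
    by rewrite sumr_const card_ord -[LHS]mulr_natl.
  have -> : \sum_(A < n)
      (0 + \sum_(B < n) (A == B)%:R / t * ((B == A)%:R / t) + 0) = n%:R / t ^+ 2.
    under eq_bigr do rewrite dd !addr0 add0r.
    by rewrite sumr_const card_ord -[LHS]mulr_natl.
  by rewrite natrD natrM; field.
- rewrite -big_split big1 //= => A _; drop_sums.
  rewrite (@sum_delta _ _ A _ (fun D => gam B A D / t)); last first.
    by move=> D; rewrite eq_sym; ring.
  rewrite (@sum_delta _ _ A _ (fun D => - gam B D A / t)); last first.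
    by move=> D; rewrite eq_sym; ring.
  by ring.
- rewrite -big_split big1 //= => C _; drop_sums.
  rewrite (@sum_delta _ _ C _ (fun D => gam A D C / t)); last first.
    by move=> D; ring.
  rewrite (@sum_delta _ _ C _ (fun D => - gam A C D / t)); last first.
    by move=> D; ring.
  by ring.
- rewrite (@sum_delta _ _ A _ (fun C => - s B C)); last first.
    by move=> C; rewrite eq_sym; field.
  rewrite [X in _ + X](@sum_delta _ _ B _ (fun C => - s C A)); last first.
    by move=> C; rewrite mulNr mulrN.
  (* upper index x^C in the first factor; p_C is the case of Y below *)
  have -> : \sum_(C < n) ((C == B)%:R / t * - (t * s A C)
     + \sum_(D < n) gam B C D * gam A D C
     + \sum_(D < n) 0 * (2^-1 * (dh A C D + dh C A D - dh D A C)
                         - \sum_(E < n) h D E * gam A E C) + 0 * - u A C)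
     = - s A B + \sum_(C < n) \sum_(D < n) gam B C D * gam A D C.
    rewrite -[- s A B](@sum_delta _ _ B (fun C => (B == C)%:R * - s A C)
      (fun C => - s A C)) //.
    rewrite -big_split /=; apply: eq_bigr => C _; drop_sums.
    by rewrite eq_sym; congr (_ + _); field.
  set X := \sum_(C < n) \sum_(D < n) _.
  have -> : X = \sum_(C < n) \sum_(D < n) gam B D C * gam A C D.
    by rewrite /X exchange_big.
  match goal with |- _ + _ + ?Y + _ = _ =>
    have -> : Y = - s A B + \sum_(C < n) \sum_(D < n) gam B D C * gam A C D end.
    rewrite -[- s A B](@sum_delta _ _ A (fun C => (A == C)%:R * - s C B)
      (fun C => - s C B)) //.
    rewrite -big_split /=; apply: eq_bigr => C _; drop_sums.
    rewrite addrC mulrN mulrN [s C B * _]mulrC; congr (_ + _).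
    by apply: eq_bigr => D _; rewrite mulrNN.
  by rewrite [s B A]s_sym; ring.
Qed.

Variable dgam : 'I_n -> 'I_n -> 'I_n -> 'I_n -> F.

(** The derivative of [symbol K I J] along its own upper index K, which is one
    term of the divergence in the Ricci tensor. For K = p_C it collects the
    coefficients of p_C in the symbol. *)
Definition dsymbol_div K I J : F :=
  match K, I, J with
  | It, Ix A, Ix B => - s A B
  | Ix C, Ix A, Ix B => dgam C A C B
  | Ip C, Ix A, Ix B =>
      dgam C A C B - dgam A B C C - dgam B A C C
      + 2 * \sum_(D < n) gam C C D * gam A D B
  | _, _, _ => 0
  end.

(** The derivative of [symbol K I K] along J, before summation over K. *)
Definition dsymbol_trace J K I : F :=
  match J, K, I with
  | It, Ix _, It | It, Ip _, It | It, Ir, It => - t ^- 2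
  | Ix B, Ix C, Ix A => dgam B A C C
  | Ix B, Ip C, Ix A => - dgam B A C C
  | _, _, _ => 0
  end.

Hypothesis s_ricci : forall A B, 2 * (n%:R - 1) * s A B =
  \sum_(C < n) (2 * dgam C A C B - dgam A B C C - dgam B A C C
    + 2 * \sum_(D < n) (gam C C D * gam A D B - gam B C D * gam A D C)).

Lemma sum_dsymbol_trace I J : sum_index (fun K => dsymbol_trace J K I) =
  match I, J with It, It => - (2 * n + 1)%:R / t ^+ 2 | _, _ => 0 end.
Proof.
rewrite /sum_index; case: I J => [|A|A|] [|B|B|] /=; drop_sums => //.
  by rewrite sumr_const card_ord -mulr_natl natrD natrM; ring.
by rewrite -big_split big1 //= => C _; rewrite addrN.
Qed.

(** The divergence of the symbols, the derivative of their trace and the two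
    quadratic sums vanish separately, except in the components (t, t) and
    (x^A, x^B). In the latter the terms in S come from the t-derivative of the symbol (-1), from
    the trace (-2n - 1) and from the quadratic term (4): their sum, -2 (n - 1),
    compensates twice the symmetrised Ricci tensor of D. *)
Lemma ricci_symbol I J :
  sum_index (fun K => dsymbol_div K I J - dsymbol_trace J K I
    + sum_index (fun L => symbol K K L * symbol L I J - symbol K J L * symbol L I K))
  = 0.
Proof.
have -> : sum_index (fun K => dsymbol_div K I J - dsymbol_trace J K I
    + sum_index (fun L => symbol K K L * symbol L I J - symbol K J L * symbol L I K))
  = sum_index (fun K => dsymbol_div K I J)
    - sum_index (fun K => dsymbol_trace J K I)
    + sum_index (fun L => sum_index (fun K => symbol K K L) * symbol L I J)
    - sum_index (fun K => sum_index (fun L => symbol K J L * symbol L I K)).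
  under eq_sum_index => K.
    rewrite sum_indexE sumrB; over.
  rewrite !sum_indexE big_split /= !sumrB addrA; congr (_ + _ - _).
    rewrite exchange_big /=; apply: eq_bigr => i _.
    by rewrite sum_indexE mulr_suml.
  by apply: eq_bigr => i _; rewrite sum_indexE.
rewrite symbol_quadratic sum_dsymbol_trace.
under [X in _ + X - _]eq_sum_index do rewrite symbol_trace.
rewrite /sum_index; case: I J => [|A|A|] [|B|B|] /=; drop_sums => //.
  by rewrite mulNr opprK addrN.
have E : \sum_(C < n) dgam C A C B + \sum_(C < n) (dgam C A C B
      - dgam A B C C - dgam B A C C + 2 * \sum_(D < n) gam C C D * gam A D B)
    = 2 * (n%:R - 1) * s A B
      + 2 * \sum_(C < n) \sum_(D < n) gam B C D * gam A D C.
  rewrite s_ricci mulr_sumr -!big_split /=; apply: eq_bigr => C _.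
  by rewrite sumrB; ring.
have -> : (2 * n + 1)%:R / t * - (t * s A B) = - ((2 * n%:R + 1) * s A B).
  by rewrite natrD natrM; field.
rewrite -[- s A B + _ + _]addrA E; ring.
Qed.

(** The function is log t: the inverse metric has no (t, t) component, which
    eliminates the second derivatives, and no (x^A, x^B) component, the only one
    where the symbols with upper index t do not vanish. *)
Lemma laplacian_symbol c :
  sum_index (fun I => sum_index (fun J => inverse_entry I J *
    ((if (I, J) is (It, It) then c else 0)
     - sum_index (fun K => symbol K I J * (if K is It then t^-1 else 0)))) ) = 0.
Proof. by rewrite /sum_index /=; drop_sums. Qed.

End Algebra.

(** * Calculus of the ambient metric *)

Lemma invmx_unique (R : comUnitRingType) m (P Q : 'M[R]_m) :
  P *m Q = 1%:M -> invmx P = Q.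
Proof.
move=> PQ; have [uP _] := mulmx1_unit PQ.
by rewrite -[RHS](mulKmx uP) PQ mulmx1.
Qed.

Section Ambient.
Variables (R : realType) (n : nat).
Variables (Gam : 'I_n -> 'I_n -> 'I_n -> 'rV[R]_n -> R).
Variables (Phi : 'rV[R]_n -> 'M[R]_n) (S : 'I_n -> 'I_n -> 'rV[R]_n -> R).

(** The family g_rho, for an arbitrary tensor S; the point is (x, p, rho). *)
Definition PW_family (y : 'rV[R]_((n + n) + 1)) : 'M[R]_(n + n) :=
  PW_form Gam (fun x => Phi x + (2 * rsubmx y 0 0) *: \matrix_(A, B) S A B x)
    (lsubmx y).

Notation G := (ambient_form PW_family).
Notation N := (1 + ((n + n) + 1))%N.
Notation dir L := (delta_mx 0 (aix L) : 'rV[R]_N).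
Implicit Types (z : 'rV[R]_N) (I J K L : ambient_index n) (A B C E : 'I_n).

Definition amb_x z : 'rV[R]_n := lsubmx (lsubmx (rsubmx z)).
Definition amb_p C z : R := rsubmx (lsubmx (rsubmx z)) 0 C.

Definition block_h A B z : R :=
  - 2 * \sum_(E < n) Gam A E B (amb_x z) * amb_p E z + Phi (amb_x z) A B
  + 2 * amb_rho z * S A B (amb_x z).

Lemma PW_family_ul z A B :
  PW_family (rsubmx z) (lshift n A) (lshift n B) = block_h A B z.
Proof.
by rewrite /PW_family /PW_form block_mxEul !mxE addrA /block_h /amb_rho !mxE.
Qed.

Lemma PW_family_ur y A B : PW_family y (lshift n A) (rshift n B) = (A == B)%:R.
Proof. by rewrite /PW_family /PW_form block_mxEur !mxE. Qed.

Lemma PW_family_dl y A B : PW_family y (rshift n A) (lshift n B) = (A == B)%:R.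
Proof. by rewrite /PW_family /PW_form block_mxEdl !mxE. Qed.

Lemma PW_family_dr y A B : PW_family y (rshift n A) (rshift n B) = 0.
Proof. by rewrite /PW_family /PW_form block_mxEdr !mxE. Qed.

Definition PW_familyE := (PW_family_ul, PW_family_ur, PW_family_dl, PW_family_dr).

Notation metricz I J z :=
  (metric_entry (amb_t z) (amb_rho z) (fun A B => block_h A B z) I J).

Lemma ambient_formE I J z : G z (aix I) (aix J) = metricz I J z.
Proof.
case: I J => [|A|A|] [|B|B|]; rewrite /ambient_form /= /ix_t /ix_x /ix_rho;
  rewrite ?(block_mxEul, block_mxEur, block_mxEdl, block_mxEdr, row_mxEl,
    row_mxEr, col_mxEu, col_mxEd);
  by rewrite [LHS]mxE /= ?PW_familyE ?mulr0 ?mxE.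
Qed.

Local Arguments aix : simpl never.

Lemma invmx_ambient I J z : amb_t z != 0 ->
  invmx (G z) (aix I) (aix J)
  = inverse_entry (amb_t z) (amb_rho z) (fun A B => block_h A B z) I J.
Proof.
move=> t0; pose Q : 'M[R]_N := \matrix_(i, j)
  inverse_entry (amb_t z) (amb_rho z) (fun A B => block_h A B z) (xia i) (xia j).
suff -> : invmx (G z) = Q by rewrite mxE !aixK.
apply: invmx_unique; apply/matrixP => i j.
rewrite -[i]xiaK -[j]xiaK [RHS]mxE eq_aix -(metric_inverse (amb_rho z)
  (fun A B => block_h A B z) t0) [LHS]mxE sum_aix.
by apply: eq_sum_index => K; rewrite ambient_formE mxE !aixK.
Qed.

Lemma amb_tE z : amb_t z = z 0 (aix It).
Proof. by rewrite /amb_t mxE; congr (z _ _); apply/val_inj. Qed.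

Lemma amb_rhoE z : amb_rho z = z 0 (aix Ir).
Proof. by rewrite /amb_rho !mxE; congr (z _ _); apply/val_inj. Qed.

Lemma amb_xE A z : amb_x z 0 A = z 0 (aix (Ix A)).
Proof. by rewrite /amb_x !mxE. Qed.

Lemma amb_pE A z : amb_p A z = z 0 (aix (Ip A)).
Proof. by rewrite /amb_p !mxE. Qed.

Lemma shiftE a L J z :
  (a *: dir L + z) 0 (aix J) = a * (same_index J L)%:R + z 0 (aix J).
Proof. by rewrite !mxE eq_aix. Qed.

Lemma amb_t_shift a L z :
  amb_t (a *: dir L + z) = (if L is It then a else 0) + amb_t z.
Proof.
by rewrite !amb_tE shiftE; congr (_ + _); case: L => *; rewrite ?mulr1 ?mulr0.
Qed.

Lemma amb_rho_shift a L z :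
  amb_rho (a *: dir L + z) = (if L is Ir then a else 0) + amb_rho z.
Proof.
by rewrite !amb_rhoE shiftE; congr (_ + _); case: L => *; rewrite ?mulr1 ?mulr0.
Qed.

Lemma amb_x_shift a L z : amb_x (a *: dir L + z)
  = (if L is Ix C then a *: delta_mx 0 C else 0) + amb_x z.
Proof.
apply/rowP => B; rewrite amb_xE shiftE [RHS]mxE -amb_xE; congr (_ + _).
by case: L => [|A|A|] /=; rewrite !mxE ?mulr0.
Qed.

Lemma amb_p_shift B a L z : amb_p B (a *: dir L + z)
  = (if L is Ip C then a * (B == C)%:R else 0) + amb_p B z.
Proof.
by rewrite !amb_pE shiftE; congr (_ + _); case: L => *; rewrite ?mulr0.
Qed.

Definition amb_shiftE := (amb_t_shift, amb_rho_shift, amb_x_shift, amb_p_shift).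

Lemma is_derive_amb_t L z : is_derive z (dir L) (@amb_t R (n + n))
  (if L is It then 1 else 0).
Proof.
apply: is_derive_affine => a; rewrite amb_t_shift.
by case: L => *; rewrite ?mulr1 ?mulr0.
Qed.

Lemma amb_x_dir C : amb_x (dir (Ix C)) = delta_mx 0 C.
Proof. by apply/rowP => B; rewrite amb_xE !mxE eq_aix. Qed.

Lemma is_derive_base f C z : differentiable f (amb_x z) ->
  is_derive z (dir (Ix C)) (f \o amb_x) (partial C f (amb_x z)).
Proof.
move=> df; apply: (is_derive_comp_linear (w := delta_mx 0 C)).
- by move=> a; rewrite amb_x_shift amb_x_dir.
- exact: amb_x_dir.
- by apply: derivableP; exact: diff_derivable.
Qed.

Variable U : set 'rV[R]_n.
Hypothesis oU : open U.
Hypothesis dGam : forall A E B x, U x -> differentiable (Gam A E B) x.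
Hypothesis dPhi : forall A B x, U x -> differentiable (fun y => Phi y A B) x.
Hypothesis dS : forall A B x, U x -> differentiable (S A B) x.
Hypothesis Gam_sym : forall A E B x, U x -> Gam A E B x = Gam B E A x.
Hypothesis Phi_sym : forall A B x, U x -> Phi x A B = Phi x B A.
Hypothesis S_sym : forall A B x, U x -> S A B x = S B A x.
Hypothesis S_ricci : forall A B x, U x -> 2 * (n%:R - 1) * S A B x =
  \sum_(C < n) (2 * partial C (Gam A C B) x - partial A (Gam B C C) x
    - partial B (Gam A C C) x
    + 2 * \sum_(E < n) (Gam C C E x * Gam A E B x - Gam B C E x * Gam A E C x)).

(** The derivative of [block_h A B] along x^C. *)
Definition dblock_h C A B z : R :=
  - 2 * \sum_(E < n) partial C (Gam A E B) (amb_x z) * amb_p E z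
  + partial C (fun x => Phi x A B) (amb_x z)
  + 2 * amb_rho z * partial C (S A B) (amb_x z).

Definition block_h0 A B z : R :=
  - 2 * \sum_(E < n) Gam A E B (amb_x z) * amb_p E z + Phi (amb_x z) A B.

Lemma is_derive_block_h L A B z : U (amb_x z) ->
  is_derive z (dir L) (block_h A B) (match L with
    | It => 0
    | Ix C => dblock_h C A B z
    | Ip C => - 2 * Gam A C B (amb_x z)
    | Ir => 2 * S A B (amb_x z)
    end).
Proof.
move=> Ux; case: L => [|C|C|].
- apply: is_derive_affine => a; rewrite mulr0 add0r /block_h !amb_shiftE !add0r.
  by under eq_bigr do rewrite !amb_shiftE !add0r.
- have dr : is_derive z (dir (Ix C)) (fun z => 2 * amb_rho z : R) 0.
    by apply: is_derive_affine => a; rewrite amb_shiftE add0r mulr0 add0r.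
  have dp E : is_derive z (dir (Ix C)) (amb_p E : _ -> R) 0.
    by apply: is_derive_affine => a; rewrite amb_shiftE add0r mulr0 add0r.
  have dG E := is_derive_base C (dGam A E B Ux).
  have dGp E := is_deriveM (dG E) (dp E).
  have D := is_deriveD (is_deriveD (is_deriveM (is_derive_cst (- 2 : R) z (dir (Ix C)))
    (is_derive_bigsum dGp)) (is_derive_base C (dPhi A B Ux)))
    (is_deriveM dr (is_derive_base C (dS A B Ux))).
  apply: (is_derive_eq D).
  rewrite !scaler0 !addr0 /dblock_h; congr (_ * _ + _ + _).
  by apply: eq_bigr => E _; rewrite scaler0 add0r; exact: mulrC.
- apply: is_derive_affine => a; rewrite /block_h !amb_shiftE !add0r.
  rewrite (eq_bigr (fun E => (C == E)%:R * (a * Gam A E B (amb_x z))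
    + Gam A E B (amb_x z) * amb_p E z)); last first.
    by move=> E _; rewrite amb_shiftE eq_sym; ring.
  rewrite big_split /= (@sum_delta _ _ C _ (fun E => a * Gam A E B (amb_x z))) //.
  by ring.
- apply: is_derive_affine => a; rewrite /block_h !amb_shiftE !add0r.
  under eq_bigr do rewrite !amb_shiftE !add0r.
  by ring.
Qed.

Notation dmetricz L I J z := (dmetric (amb_t z) (fun A B => block_h A B z)
  (fun A B => S A B (amb_x z)) (fun A C B => Gam A C B (amb_x z))
  (fun C A B => dblock_h C A B z) L I J).

Lemma is_derive_metric L I J z : U (amb_x z) ->
  is_derive z (dir L) (fun y => G y (aix I) (aix J)) (dmetricz L I J z).
Proof.
move=> Ux; have -> : (fun y => G y (aix I) (aix J)) = (fun y => metricz I J y).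
  by apply/funext => y; rewrite ambient_formE.
have dtt : is_derive z (dir L) (fun y => amb_t y ^+ 2)
    (if L is It then 2 * amb_t z else 0).
  apply: is_derive_eq (is_derive_prod (is_derive_amb_t L z) (is_derive_amb_t L z)) _.
  by case: L => *; ring.
have dr : is_derive z (dir L) (fun y => 2 * amb_rho y) (if L is Ir then 2 else 0).
  apply: is_derive_affine => a; rewrite amb_shiftE.
  by case: L {dtt} => *; ring.
have dtc (c : R) : is_derive z (dir L) (fun y => amb_t y ^+ 2 * c)
    (if L is It then 2 * amb_t z * c else 0).
  apply: is_derive_eq (is_derive_prod dtt (is_derive_cst (c : R) z (dir L))) _.
  by case: L {dtt dr} => *; rewrite /cst; ring.
case: I J => [|A|A|] [|B|B|] //=; try exact: is_derive_cst;
  try exact: is_derive_amb_t.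
apply: is_derive_eq (is_derive_prod dtt (is_derive_block_h L A B Ux)) _.
by case: L {dtt dr dtc} => *; rewrite /=; ring.
Qed.

Notation symbolz K I J z := (symbol (amb_t z) (fun A B => block_h A B z)
  (fun A B => S A B (amb_x z)) (fun A B => block_h0 A B z)
  (fun A C B => Gam A C B (amb_x z)) (fun C A B => dblock_h C A B z) K I J).

Lemma block_h_sym A B z : U (amb_x z) -> block_h A B z = block_h B A z.
Proof.
move=> Ux; rewrite /block_h (Phi_sym _ _ Ux) (S_sym _ _ Ux).
by under eq_bigr do rewrite (Gam_sym _ _ _ Ux).
Qed.

Lemma christoffel_ambient K I J z : U (amb_x z) -> amb_t z != 0 ->
  christoffel G (aix K) (aix I) (aix J) z = symbolz K I J z.
Proof.
move=> Ux t0; rewrite -(symbol_dmetric (rho := amb_rho z)) //.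
- rewrite /christoffel sum_aix; congr (_ * _); apply: eq_sum_index => L.
  rewrite invmx_ambient //; congr (_ * (_ + _ - _)); rewrite /partial;
    exact: (@derive_val _ _ _ _ _ _ _ (is_derive_metric _ _ _ Ux)).
- by move=> A B; rewrite block_h_sym.
- by move=> A B; rewrite S_sym.
Qed.

Definition ambient_domain : set 'rV[R]_N :=
  [set z | 0 < amb_t z /\ U (amb_x z)].

Lemma open_ambient_domain : open ambient_domain.
Proof.
have cx : continuous amb_x.
  move=> z; apply: (@continuous_comp _ _ _ (fun z => lsubmx (rsubmx z)) lsubmx).
    apply: (@continuous_comp _ _ _ rsubmx lsubmx);
      [exact: continuous_rsubmx|exact: continuous_lsubmx].
  exact: continuous_lsubmx.
have ct : continuous (@amb_t R (n + n)).
  move=> z; apply: differentiable_continuous.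
  rewrite (_ : @amb_t R _ = fun z => z 0 (aix It));
    [exact: differentiable_coord | apply/funext => y; exact: amb_tE].
apply: openI.
  apply: (@open_comp _ _ (@amb_t R (n + n)) [set r : R | 0 < r]).
    by move=> z _; exact: ct.
  exact: open_gt.
by apply: (@open_comp _ _ amb_x) => // z _; exact: cx.
Qed.

Notation dsymbol_divz K I J z := (dsymbol_div (fun A B => S A B (amb_x z))
  (fun A C B => Gam A C B (amb_x z))
  (fun C A E B => partial C (Gam A E B) (amb_x z)) K I J).

Notation dsymbol_tracez J K I z := (dsymbol_trace (amb_t z)
  (fun C A E B => partial C (Gam A E B) (amb_x z)) J K I).

(** Most entries are constant along their own upper index. The exceptions are
    linear in t, or Gamma along x^C, or the entry (p_C; x^A, x^B), which is
    affine in p because it is linear in the dx dx block and its x-derivatives. *)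
Lemma is_derive_symbol_div K I J z : ambient_domain z ->
  is_derive z (dir K) (fun y => symbolz K I J y) (dsymbol_divz K I J z).
Proof.
move=> [t_gt0 Ux].
case: K I J => [|C|C|] [|A|A|] [|B|B|] //=; try exact: is_derive_cst;
  try (by apply: is_derive_affine => a; rewrite !amb_shiftE !add0r mulr0 add0r).
- by apply: is_derive_affine => a; rewrite !amb_shiftE !add0r; ring.
- exact: is_derive_base (dGam A C B Ux).
- have dh_shift a D E F : dblock_h D E F (a *: dir (Ip C) + z)
      = a * (- 2 * partial D (Gam E C F) (amb_x z)) + dblock_h D E F z.
    rewrite /dblock_h !amb_shiftE !add0r.
    rewrite (eq_bigr (fun H => (C == H)%:R * (a * partial D (Gam E H F) (amb_x z))
      + partial D (Gam E H F) (amb_x z) * amb_p H z)); last first.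
      by move=> H _; rewrite amb_shiftE eq_sym; ring.
    rewrite big_split /=
      (@sum_delta _ _ C _ (fun H => a * partial D (Gam E H F) (amb_x z))) //.
    by ring.
  have h_shift a E F : block_h E F (a *: dir (Ip C) + z)
      = a * (- 2 * Gam E C F (amb_x z)) + block_h E F z.
    rewrite /block_h !amb_shiftE !add0r.
    rewrite (eq_bigr (fun H => (C == H)%:R * (a * Gam E H F (amb_x z))
      + Gam E H F (amb_x z) * amb_p H z)); last first.
      by move=> H _; rewrite amb_shiftE eq_sym; ring.
    rewrite big_split /= (@sum_delta _ _ C _ (fun H => a * Gam E H F (amb_x z))) //.
    by ring.
  apply: is_derive_affine => a; rewrite !dh_shift !amb_shiftE !add0r.
  rewrite (eq_bigr (fun D => - 2 * a * (Gam C C D (amb_x z) * Gam A D B (amb_x z))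
     + block_h C D z * Gam A D B (amb_x z))); last by move=> D _; rewrite h_shift; ring.
  by rewrite big_split /= -mulr_sumr; field.
- apply: is_derive_affine => a; rewrite /block_h0 !amb_shiftE !add0r mulr0 add0r.
  by under eq_bigr do rewrite !amb_shiftE !add0r.
Qed.

Lemma is_derive_symbol_trace J K I z : ambient_domain z ->
  is_derive z (dir J) (fun y => symbolz K I K y) (dsymbol_tracez J K I z).
Proof.
move=> [t_gt0 Ux].
have dV L : is_derive z (dir L) (fun y => (amb_t y)^-1)
    (if L is It then - (amb_t z) ^- 2 else 0).
  have t0 : amb_t z != 0 by rewrite gt_eqF.
  have dt := is_derive_amb_t L z.
  split; first by apply: derivableV => //; case: dt.
  by rewrite deriveV // (@derive_val _ _ _ _ _ _ _ dt); case: L {dt} => *;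
    rewrite ?scaler0 // /GRing.scale /= mulr1.
have dc (c : R) L : is_derive z (dir L) (fun y => c / amb_t y)
    (if L is It then - c / (amb_t z) ^+ 2 else 0).
  apply: is_derive_eq (is_derive_prod (is_derive_cst c z (dir L)) (dV L)) _.
  by case: L => *; rewrite /cst; ring.
have dG A E B L : is_derive z (dir L) (fun y => Gam A E B (amb_x y))
    (if L is Ix C then partial C (Gam A E B) (amb_x z) else 0).
  case: L => [|C|C|]; last 1 first.
  all: try (by apply: is_derive_affine => a; rewrite !amb_shiftE !add0r mulr0 add0r).
  exact: is_derive_base (dGam A E B Ux).
case: K I => [|C|C|] [|A|A|] //=; try (by case: J => *; exact: is_derive_cst).
- apply: is_derive_eq (dc _ _) _.
  by case: J => *; rewrite //= eqxx mulN1r.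
- apply: is_derive_eq (dc _ _) _.
  by case: J => *; rewrite //= eqxx mulN1r.
- apply: is_derive_eq (is_deriveN (dG A C C J)) _.
  by case: J => *; rewrite ?oppr0.
Qed.

(** The Ricci tensor differentiates the symbols once more, hence their table is
    needed on an open set and not only at the given point. *)
Lemma ricci_ambient i j z : ambient_domain z -> ricci G i j z = 0.
Proof.
move=> Oz; have [t_gt0 Ux] := Oz.
have t0 y : ambient_domain y -> amb_t y != 0 by move=> [ty _]; rewrite gt_eqF.
have oO := open_ambient_domain.
rewrite -[i]xiaK -[j]xiaK; set I := xia i; set J := xia j.
have chr K X Y y : ambient_domain y ->
    christoffel G (aix K) (aix X) (aix Y) y = symbolz K X Y y.
  by move=> Oy; apply: christoffel_ambient; [case: Oy|exact: t0].
have pchr L K X Y : partial (aix L) (christoffel G (aix K) (aix X) (aix Y)) z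
    = 'D_(dir L) (fun y => symbolz K X Y y) z.
  by apply: (derive_eq_on _ oO Oz) => y; rewrite inE => Oy; exact: chr.
rewrite /ricci sum_aix.
rewrite -[RHS](@ricci_symbol _ _ (amb_t z) (fun A B => block_h A B z)
  (fun A B => S A B (amb_x z)) (fun A B => block_h0 A B z)
  (fun A C B => Gam A C B (amb_x z)) (fun C A B => dblock_h C A B z) _ _ _
  (fun C A E B => partial C (Gam A E B) (amb_x z)) _ I J).
- apply: eq_sum_index => K; rewrite !pchr sum_aix.
  rewrite (@derive_val _ _ _ _ _ _ _ (is_derive_symbol_div K I J Oz)).
  rewrite (@derive_val _ _ _ _ _ _ _ (is_derive_symbol_trace J K I Oz)).
  by congr (_ + _); apply: eq_sum_index => L; rewrite !chr.
- exact: t0.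
- by move=> A C B; rewrite (Gam_sym _ _ _ Ux).
- by move=> A B; rewrite (S_sym _ _ Ux).
- by move=> A B; rewrite (S_ricci _ _ Ux).
Qed.

Lemma amb_t_dir : amb_t (dir It) = 1.
Proof. by rewrite amb_tE mxE eqxx eq_aix. Qed.

Lemma laplacian_ln_ambient z : ambient_domain z ->
  laplacian G (fun y => ln (amb_t y)) z = 0.
Proof.
move=> Oz; have oO := open_ambient_domain.
have dln L y : ambient_domain y ->
    is_derive y (dir L) (fun y => ln (amb_t y) : R) (if L is It then (amb_t y)^-1 else 0).
  move=> [ty Ux]; case: L => [|C|C|];
    try (by apply: is_derive_affine => a; rewrite amb_shiftE add0r mulr0 add0r).
  apply: (is_derive_comp_linear (L := @amb_t R (n + n)) (w := 1)).
  - by move=> a; rewrite amb_t_shift amb_t_dir [_ *: _]mulr1.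
  - exact: amb_t_dir.
  - exact: is_derive1_ln.
have pln L y : ambient_domain y -> partial (aix L) (fun y => ln (amb_t y)) y
    = if L is It then (amb_t y)^-1 else 0.
  by move=> Oy; exact: (@derive_val _ _ _ _ _ _ _ (dln L y Oy)).
pose c := partial (aix It) (partial (aix It) (fun y => ln (amb_t y))) z.
have ppln I J : partial (aix I) (partial (aix J) (fun y => ln (amb_t y))) z
    = if (I, J) is (It, It) then c else 0.
  have -> : partial (aix I) (partial (aix J) (fun y => ln (amb_t y))) z
      = 'D_(dir I) (fun y => if J is It then (amb_t y)^-1 else 0) z.
    by apply: (derive_eq_on _ oO Oz) => y; rewrite inE => Oy; exact: pln.
  case: J => [|C|C|]; last 3 first.
  1-3: by case: I => *; exact: derive_cst.
  case: I => [|C|C|].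
    apply: (derive_eq_on _ oO Oz) => y; rewrite inE => Oy; exact/esym/(pln It).
  1-3: match goal with |- 'D_?v ?f ?y = _ =>
    suff D : is_derive y v f 0 by exact: (@derive_val _ _ _ _ _ _ _ D) end.
  1-3: by apply: is_derive_affine => a; rewrite amb_shiftE add0r mulr0 add0r.
have [t_gt0 Ux] := Oz; have t0 : amb_t z != 0 by rewrite gt_eqF.
rewrite /laplacian sum_aix.
rewrite -[RHS](@laplacian_symbol _ _ (amb_t z) (amb_rho z) (fun A B => block_h A B z)
  (fun A B => S A B (amb_x z)) (fun A B => block_h0 A B z)
  (fun A C B => Gam A C B (amb_x z)) (fun C A B => dblock_h C A B z) c).
apply: eq_sum_index => I; rewrite sum_aix; apply: eq_sum_index => J.
rewrite invmx_ambient // ppln sum_aix; congr (_ * (_ - _)).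
by apply: eq_sum_index => K; rewrite christoffel_ambient // pln.
Qed.
End Ambient.

(** * The Q-curvature in a chart *)

Section Coordinates.
Variables (R : realType) (n : nat).
Hypothesis hn : (2 <= n)%N.
Variable U : set 'rV[R]_n.
Hypothesis oU : open U.
Variable Gam : 'I_n -> 'I_n -> 'I_n -> 'rV[R]_n -> R.
Hypothesis sGam : forall A C B, smooth_on U (Gam A C B).
Hypothesis Gam_sym : forall A C B x, U x -> Gam A C B x = Gam B C A x.
Variable Phi : 'rV[R]_n -> 'M[R]_n.
Hypothesis sPhi : smooth_mx_on U Phi.
Hypothesis Phi_sym : forall x, U x -> (Phi x)^T = Phi x.

(** The symmetrised Ricci tensor of D, divided by n - 1. The coefficients are
    written as products so that the sum is visibly built from smooth functions. *)
Definition proj_schouten (A B : 'I_n) (x : 'rV[R]_n) : R :=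
  (n%:R - 1)^-1 * \sum_(C < n) (partial C (Gam A C B) x
    + - 2^-1 * partial A (Gam B C C) x + - 2^-1 * partial B (Gam A C C) x
    + \sum_(E < n) (Gam C C E x * Gam A E B x + - 1 * (Gam B C E x * Gam A E C x))).

Notation S := proj_schouten.
Notation gr := (PW_family Gam Phi S).

Lemma proj_schouten_sym A B x : U x -> S A B x = S B A x.
Proof.
move=> Ux; rewrite /S; congr (_ * _); rewrite !big_split /=.
have -> : \sum_(C < n) partial C (Gam A C B) x = \sum_(C < n) partial C (Gam B C A) x.
  apply: eq_bigr => C _; apply: (derive_eq_on _ oU Ux) => y.
  by rewrite inE => Uy; exact: Gam_sym.
have -> : \sum_(C < n) \sum_(E < n)
      (Gam C C E x * Gam A E B x + - 1 * (Gam B C E x * Gam A E C x))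
    = \sum_(C < n) \sum_(E < n)
      (Gam C C E x * Gam B E A x + - 1 * (Gam A C E x * Gam B E C x)).
  under eq_bigr do rewrite big_split /=.
  under [RHS]eq_bigr do rewrite big_split /=.
  rewrite !big_split /=; congr (_ + _).
    by apply: eq_bigr => C _; apply: eq_bigr => E _; rewrite (Gam_sym A).
  rewrite exchange_big /=; apply: eq_bigr => C _; apply: eq_bigr => E _.
  by rewrite [Gam B _ _ _ * _]mulrC.
by congr (_ + _); rewrite -!addrA; congr (_ + _); exact: addrC.
Qed.

Lemma proj_schouten_ricci A B x : 2 * (n%:R - 1) * S A B x =
  \sum_(C < n) (2 * partial C (Gam A C B) x - partial A (Gam B C C) x
    - partial B (Gam A C C) x
    + 2 * \sum_(E < n) (Gam C C E x * Gam A E B x - Gam B C E x * Gam A E C x)).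
Proof.
have n1 : n%:R - 1 != 0 :> R by rewrite subr_eq0 pnatr_eq1 gtn_eqF.
rewrite /S mulrA mulfK // mulr_sumr; apply: eq_bigr => C _.
rewrite (eq_bigr (fun E => Gam C C E x * Gam A E B x - Gam B C E x * Gam A E C x)).
  by field.
by move=> E _; rewrite mulN1r.
Qed.

Lemma smooth_proj_schouten A B : smooth_on U (S A B).
Proof.
apply: smoothM => //; first exact: smooth_cst.
apply: smooth_sum => // C; apply: smoothD => //; first apply: smoothD => //;
  first apply: smoothD => //.
- exact: smooth_partial.
- by apply: smoothM => //; [exact: smooth_cst|exact: smooth_partial].
- by apply: smoothM => //; [exact: smooth_cst|exact: smooth_partial].
apply: smooth_sum => // E; apply: smoothD => //; first exact: smoothM.
by apply: smoothM => //; [exact: smooth_cst|exact: smoothM].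
Qed.

Definition family_domain : set 'rV[R]_((n + n) + 1) :=
  [set y | U (lsubmx (lsubmx y))].

Lemma open_family_domain : open family_domain.
Proof.
apply: (@open_comp _ _ (fun y : 'rV[R]_((n + n) + 1) => lsubmx (lsubmx y))) => // y _.
by apply: (@continuous_comp _ _ _ lsubmx lsubmx); exact: continuous_lsubmx.
Qed.

(** The projection (x, p, rho) -> x maps the coordinate basis to basis vectors or
    to 0. *)
Lemma smooth_base f : smooth_on U f ->
  smooth_on family_domain (fun y => f (lsubmx (lsubmx y))).
Proof.
apply: (@smooth_comp _ _ _ U (fun y : 'rV[R]_((n + n) + 1) => lsubmx (lsubmx y))).
- move=> y; apply: (@differentiable_comp _ _ _ _ lsubmx lsubmx);
    exact: differentiable_lsubmx.
- by move=> a x y; apply/rowP => A; rewrite !mxE.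
- move=> i; case: (fintype.split_ordP i) => [j ->|j ->]; last first.
    by left; apply/rowP => A; rewrite !mxE eq_shift.
  case: (fintype.split_ordP j) => [C ->|C ->]; last first.
    by left; apply/rowP => A; rewrite !mxE !eq_shift.
  by right; exists C; apply/rowP => A; rewrite !mxE !eq_shift.
Qed.

Lemma smooth_family : smooth_mx_on family_domain gr.
Proof.
have oO := open_family_domain.
move=> i j; case: (fintype.split_ordP i) => [A ->|A ->];
  case: (fintype.split_ordP j) => [B ->|B ->].
- have -> : (fun y => gr y (lshift n A) (lshift n B)) = (fun y =>
      - 2 * (\sum_(C < n) Gam A C B (lsubmx (lsubmx y)) * y 0 (lshift 1 (rshift n C)))
      + Phi (lsubmx (lsubmx y)) A B
      + 2 * y 0 (rshift (n + n) ord0) * S A B (lsubmx (lsubmx y))).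
    apply/funext => y; rewrite /PW_family /PW_form block_mxEul !mxE addrA.
    congr (_ * _ + _ + _).
    by apply: eq_bigr => C _; rewrite !mxE.
  have coord k : smooth_on family_domain (fun y : 'rV[R]_((n + n) + 1) => y 0 k).
    apply: smooth_linear; first by move=> y; exact: differentiable_coord.
    by move=> a x y; rewrite !mxE.
  apply: smoothD => //; first apply: smoothD => //.
  + apply: smoothM => //; first exact: smooth_cst.
    apply: smooth_sum => // C; apply: smoothM => //.
    exact: smooth_base (sGam A C B).
  + exact: smooth_base (sPhi A B).
  + apply: smoothM => //; last exact: smooth_base (smooth_proj_schouten A B).
    by apply: smoothM => //; exact: smooth_cst.
- by under eq_fun do rewrite PW_family_ur; exact: smooth_cst.
- by under eq_fun do rewrite PW_family_dl; exact: smooth_cst.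
- by under eq_fun do rewrite PW_family_dr; exact: smooth_cst.
Qed.

Lemma family_sym y : family_domain y -> (gr y)^T = gr y.
Proof.
move=> Uy; rewrite /PW_family /PW_form tr_block_mx !trmx1 trmx0; congr block_mx.
rewrite !linearD /= linearZ /= Phi_sym //; congr (_ + (_ + _ *: _)).
  apply/matrixP => A B; rewrite !mxE; congr (_ * _); apply: eq_bigr => C _.
  by rewrite (Gam_sym A).
by apply/matrixP => A B; rewrite !mxE; exact: proj_schouten_sym.
Qed.

Lemma PW_form_unitmx (P : 'rV[R]_n -> 'M[R]_n) z : PW_form Gam P z \in unitmx.
Proof.
rewrite /PW_form; set h := (X in block_mx X _ _ _).
have := @mulmx1_unit _ _ (block_mx h 1%:M 1%:M 0) (block_mx 0 1%:M 1%:M (- h)).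
case=> //; rewrite mulmx_block !mulmx1 !mul1mx !mulmx0 !mul0mx !addr0 add0r.
by rewrite addrN scalar_mx_block.
Qed.

Notation G := (ambient_form gr).

Lemma amb_point_domain t x : 0 < t -> U (lsubmx x) ->
  ambient_domain U (amb_point t x 0 : 'rV[R]_(1 + ((n + n) + 1))).
Proof.
move=> t0 Ux; split; first by rewrite /amb_t /amb_point row_mxKl mxE eqxx.
by rewrite /amb_x /amb_point row_mxKr row_mxKl.
Qed.

Lemma ricci_family i j z : ambient_domain U z -> ricci G i j z = 0.
Proof.
apply: ricci_ambient => //.
- by move=> A E B x; exact: smooth_differentiable (sGam A E B).
- by move=> A B x; exact: smooth_differentiable (sPhi A B).
- by move=> A B x; exact: smooth_differentiable (smooth_proj_schouten A B).
- by move=> A B x Ux; rewrite -[in LHS](Phi_sym Ux) mxE.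
- by move=> A B x; exact: proj_schouten_sym.
- by move=> A B x _; exact: proj_schouten_ricci.
Qed.

(** Already the first Laplacian of log t vanishes on an open set, and so do then
    all the further ones. *)
Lemma iter_laplacian_ln k z : ambient_domain U z ->
  iter k.+1 (fun f y => - laplacian G f y) (fun y => ln (amb_t y)) z = 0.
Proof.
elim: k z => [|k IH] z Oz.
  rewrite /= (laplacian_ln_ambient oU) ?oppr0 //.
  - by move=> A E B x; exact: smooth_differentiable (sGam A E B).
  - by move=> A B x; exact: smooth_differentiable (sPhi A B).
  - by move=> A B x; exact: smooth_differentiable (smooth_proj_schouten A B).
  - by move=> A B x Ux; rewrite -[in LHS](Phi_sym Ux) mxE.
  - by move=> A B x; exact: proj_schouten_sym.
rewrite iterS; move: (iter _ _ _) IH => f f0.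
have oO := open_ambient_domain oU.
have p0 h i : (forall y, ambient_domain U y -> h y = 0) ->
    forall y, ambient_domain U y -> partial i h y = 0.
  exact: (@vanish_iter_partial _ _ _ h i 1 oO).
rewrite /laplacian big1 ?oppr0 // => i _; rewrite big1 // => j _.
rewrite (p0 _ i (p0 _ j f0)) // sub0r.
by rewrite big1 ?oppr0 ?mulr0 // => l _; rewrite p0 ?mulr0.
Qed.

Variables (W : set 'rV[R]_(n + n)) (g : 'rV[R]_(n + n) -> 'M[R]_(n + n)).
Hypothesis WU : forall z, W z -> U (lsubmx z).
Hypothesis gE : forall z, W z -> g z = PW_form Gam Phi z.

(** The Ricci tensor vanishes identically on the open set t > 0 lying over U, so
    its derivatives in rho vanish to all orders. *)
Lemma PW_is_ambient : is_ambient W g gr.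
Proof.
have oO := open_ambient_domain oU.
have Orho0 m f : (forall z, ambient_domain U z -> f z = 0) -> Orho W m f.
  move=> f0 j t x _ t0 Wx; apply: (vanish_iter_partial _ _ oO f0).
  exact/amb_point_domain/WU.
split.
- exists family_domain; split.
  + exact: open_family_domain.
  + by move=> x Wx; rewrite /family_domain /= row_mxKl; exact: WU.
  + exact: smooth_family.
  + by move=> y Uy; split; [exact: family_sym|exact: PW_form_unitmx].
- move=> x Wx; rewrite gE // /PW_family row_mxKl row_mxKr mxE mulr0.
  by rewrite /PW_form scale0r addr0.
- by move=> I J; apply: Orho0 => z Oz; exact: ricci_family.
- split; first by apply: Orho0 => z Oz; exact: ricci_family.
    by move=> i; apply: Orho0 => z Oz; exact: ricci_family.
  apply: Orho0 => z Oz; rewrite big1 // => i _; rewrite big1 // => j _.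
  by rewrite ricci_family ?mulr0.
Qed.

Lemma PW_Qcurvature_in_coordinates : Qcurvature_in_coordinates W g (fun=> 0).
Proof.
exists gr; first exact: PW_is_ambient.
have n2 : (n + n)./2 = n.-1.+1 by rewrite addnn doubleK (ltn_predK hn).
move=> x Wx; rewrite n2 iter_laplacian_ln ?oppr0 //.
by apply: amb_point_domain; [exact: ltr01|exact: WU].
Qed.

End Coordinates.

(** * Charts of the cotangent bundle *)

Lemma open_chart_image (R : realType) (d : nat) (M : smoothManifold R d)
  (i : chart_index M) : open (chart_image i).
Proof.
case: M i => T I dom ch tr ? ? odom ? ? ? och ? ? i.
exact: och (odom i) (@subset_refl _ _).
Qed.

Lemma tcomp_smooth (R : realType) (d : nat) (M : smoothManifold R d)
  (Phi : symTensor M) i : smooth_mx_on (chart_image i) (Phi i).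
Proof. by case: Phi => c sm ? ?; exact: sm. Qed.

Lemma tcomp_sym (R : realType) (d : nat) (M : smoothManifold R d)
  (Phi : symTensor M) i x : chart_image i x -> (Phi i x)^T = Phi i x.
Proof. by case: Phi => c ? sym ?; exact: sym. Qed.

Lemma conn_smooth (R : realType) (d : nat) (M : smoothManifold R d)
  (D : torsionFreeConnection M) i A C B : smooth_on (chart_image i) (D i A C B).
Proof. by case: D => c sm ? ?; exact: sm. Qed.

Lemma conn_sym (R : realType) (d : nat) (M : smoothManifold R d)
    (D : torsionFreeConnection M) i A C B x :
  chart_image i x -> D i A C B x = D i B C A x.
Proof. by case: D => c ? sym ?; exact: sym. Qed.

Lemma base_chart_image (R : realType) (n : nat) (M : smoothManifold R n)
    (T : cotangentBundle M) (k : chart_index T) z :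
  chart_image k z -> chart_image (base_chart k) (lsubmx z).
Proof.
case: T k => T pr bc ? dom lsub ? ? k [m km <-] /=.
by rewrite lsub //; exists (pr m) => //; move: km; rewrite dom.
Qed.

Theorem theorem7p2 (R : realType) (n : nat) (hn : (2 <= n)%N)
    (M : smoothManifold R n) (orM : oriented M)
    (D : torsionFreeConnection M) (spD : special D)
    (Phi : symTensor M) (T : cotangentBundle M)
    (g : pseudoRiemannianMetric T) (hg : is_modified_PW D Phi g) :
  is_Qcurvature g (fun _ : T => 0).
Proof.
move=> k; exists (fun=> 0) => //.
apply: (@PW_Qcurvature_in_coordinates _ _ hn (chart_image (base_chart k)) _
  (D (base_chart k)) _ _ (Phi (base_chart k))).
- exact: open_chart_image.
- exact: conn_smooth.
- by move=> A C B x; exact: conn_sym.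
- exact: tcomp_smooth.
- by move=> x; exact: tcomp_sym.
- by move=> z; exact: base_chart_image.
- exact: hg.
Qed.
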